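(* For a finite rack $(X,\triangleleft)$, the following conditions are equivalent: (1) $(X,\triangleleft)$ is injective; (2) $(X,\triangleleft)$ is isomorphic to a sub-quandle of a finite conjugation quandle; (3) $(X,\triangleleft)$ is isomorphic to a sub-quandle of a conjugation quandle.
   Context: A (right) rack $(X,\triangleleft)$ is a set $X$ with a binary operation satisfying $(x\triangleleft y)\triangleleft z=(x\triangleleft z)\triangleleft(y\triangleleft z)$ for all $x,y,z$, such that every right translation $x\mapsto x\triangleleft y$ is a bijection of $X$. A quandle is a rack with $x\triangleleft x=x$ for all $x$. The structure group of a rack is $G_{(X,\triangleleft)}=\langle X\mid xy=y\,(x\triangleleft y),\ x,y\in X\rangle$; the rack is injective if the natural map $\iota\colon X\to G_{(X,\triangleleft)}$, $x\mapsto x$, is injective. The conjugation quandle of a group $H$ is the set $H$ with the operation $g\triangleleft_{Conj}h=h^{-1}gh$; it is finite if $H$ is finite. *)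

(* Defs.v *)
From HB Require Import structures.
From mathcomp Require Import all_boot all_fingroup generic_quotient.
From mathcomp Require Import boolp classical_sets.

Set Implicit Arguments.
Unset Strict Implicit.
Unset Printing Implicit Defensive.

Import Algebra.
Local Open Scope group_scope.
Local Open Scope quotient_scope.

(** * Racks and quandles *)

Reserved Notation "x ◁ y" (at level 40, left associativity).

HB.mixin Record isRack (X : Type) := {
  rack_op : X -> X -> X;
  rack_op_distr : forall x y z,
    rack_op (rack_op x y) z = rack_op (rack_op x z) (rack_op y z);
  rack_op_bij : forall y, bijective (fun x => rack_op x y)
}.

#[short(type="rackType")]
HB.structure Definition Rack := {X of isRack X}.

Notation "x ◁ y" := (rack_op x y).

HB.mixin Record Rack_isQuandle X of Rack X := {
  rack_opxx : forall x : X, x ◁ x = x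
}.

#[short(type="quandleType")]
HB.structure Definition Quandle := {X of Rack_isQuandle X & Rack X}.

#[short(type="finRackType")]
HB.structure Definition FinRack := {X of Rack X & Finite X}.

Definition rack_isomorphic (X Y : rackType) : Prop :=
  exists f : X -> Y, bijective f /\ (forall x y, f (x ◁ y) = f x ◁ f y).

(** A subset that is a quandle for the induced operation: the right
    translations by its elements must restrict to bijections of the subset, and
    for infinite subsets closure under [◁] alone does not give the surjectivity.
    The empty subset is allowed, as is the empty rack. *)
Record subquandle (Q : quandleType) := SubQuandle {
  subquandle_set :> set Q;
  subquandle_op : forall x y,
    subquandle_set x -> subquandle_set y -> subquandle_set (x ◁ y);
  subquandle_surj : forall x y,
    subquandle_set x -> subquandle_set y ->
    exists2 z, subquandle_set z & z ◁ y = x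
}.

Section SubQuandleType.
Variables (Q : quandleType) (S : subquandle Q).

Definition subquandle_type : Type := set_type S.

Definition sub_op (x y : subquandle_type) : subquandle_type :=
  SigSub (mem_set (subquandle_op (set_valP x) (set_valP y))).

Lemma sub_opA x y z : sub_op (sub_op x y) z = sub_op (sub_op x z) (sub_op y z).
Proof. by apply: val_inj; rewrite /= rack_op_distr. Qed.

Lemma sub_op_bij y : bijective (fun x => sub_op x y).
Proof.
have surj (x : subquandle_type) : exists z : subquandle_type, sub_op z y = x.
  have [z Sz zy] := subquandle_surj (set_valP x) (set_valP y).
  by exists (SigSub (mem_set Sz)); apply: val_inj.
have [g gP] := choice surj; exists g => // x.
apply: val_inj; apply: (bij_inj (rack_op_bij (val y))).
exact: (congr1 val (gP (sub_op x y))).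
Qed.

Lemma sub_opxx x : sub_op x x = x.
Proof. by apply: val_inj; rewrite /= rack_opxx. Qed.

HB.instance Definition _ := isRack.Build subquandle_type sub_opA sub_op_bij.
HB.instance Definition _ := Rack_isQuandle.Build subquandle_type sub_opxx.

End SubQuandleType.

(** * Conjugation quandles *)

(** [g ^ h] is [h^-1 * (g * h)]. *)
Definition conj_quandle (H : groupType) : Type := H.

Section ConjQuandle.
Variable H : groupType.

Definition conj_op (g h : conj_quandle H) : conj_quandle H := (g : H) ^ (h : H).

Lemma conj_opA x y z :
  conj_op (conj_op x y) z = conj_op (conj_op x z) (conj_op y z).
Proof. by rewrite /conj_op conjJg. Qed.

Lemma conj_op_bij y : bijective (fun x => conj_op x y).
Proof.
by exists (fun x : H => x ^ y^-1) => x; rewrite /conj_op ?conjgK ?conjgKV.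
Qed.

Lemma conj_opxx x : conj_op x x = x.
Proof. by rewrite /conj_op conjgE mulKg. Qed.

HB.instance Definition _ := isRack.Build (conj_quandle H) conj_opA conj_op_bij.
HB.instance Definition _ := Rack_isQuandle.Build (conj_quandle H) conj_opxx.

End ConjQuandle.

(** * Groups defined by generators and relations *)

(** The letter [(x, false)] stands for [x] and [(x, true)] for [x^-1].
    [{classic _}] provides the choice structure that quotients and
    [groupType] require, at no cost for an arbitrary type [X]. *)
Definition word (X : Type) : choiceType := {classic seq (X * bool)}.

Section Presentation.
Variables (X : Type) (R : word X -> word X -> Prop).

Inductive pres_eq : word X -> word X -> Prop :=
| PresRel u v : R u v -> pres_eq u v
| PresCancel x b : pres_eq [:: (x, b); (x, ~~ b)] [::]
| PresCat u u' v v' : pres_eq u u' -> pres_eq v v' -> pres_eq (u ++ v) (u' ++ v')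
| PresRefl u : pres_eq u u
| PresSym u v : pres_eq u v -> pres_eq v u
| PresTrans u v w : pres_eq u v -> pres_eq v w -> pres_eq u w.

Definition pres_rel (u v : word X) : bool := `[< pres_eq u v >].

Lemma pres_rel_refl : reflexive pres_rel.
Proof. by move=> u; apply/asboolP; exact: PresRefl. Qed.

Lemma pres_rel_sym : symmetric pres_rel.
Proof. by move=> u v; apply/asboolP/asboolP; exact: PresSym. Qed.

Lemma pres_rel_trans : transitive pres_rel.
Proof.
by move=> v u w /asboolP uv /asboolP vw; apply/asboolP; apply: PresTrans vw.
Qed.

Canonical pres_equiv := EquivRel pres_rel pres_rel_refl pres_rel_sym pres_rel_trans.

Definition presented : Type := {eq_quot pres_equiv}.

HB.instance Definition _ := Choice.on presented.

Definition pres_class (w : word X) : presented := \pi_({eq_quot pres_equiv}) w.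
Definition pres_repr (g : presented) : word X := repr (g : {eq_quot pres_equiv}).

Lemma pres_reprK : cancel pres_repr pres_class.
Proof. exact: reprK. Qed.

Lemma pres_classP u v : pres_class u = pres_class v <-> pres_eq u v.
Proof. by split=> [/eqmodP /asboolP | uv]; last exact/eqmodP/asboolP. Qed.

Lemma pres_classK w : pres_eq (pres_repr (pres_class w)) w.
Proof. by apply/pres_classP; rewrite pres_reprK. Qed.

Definition winv (w : word X) : word X := rev [seq (a.1, ~~ a.2) | a <- w].

Definition pres_one : presented := pres_class [::].
Definition pres_mul (g h : presented) : presented :=
  pres_class (pres_repr g ++ pres_repr h).
Definition pres_inv (g : presented) : presented := pres_class (winv (pres_repr g)).

Lemma winvK : involutive winv.
Proof.
move=> w; rewrite /winv map_rev revK -map_comp -[RHS]map_id.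
by apply: eq_map => -[x b] /=; rewrite negbK.
Qed.

Lemma winv_cat (w : word X) : pres_eq (w ++ winv w) [::].
Proof.
elim: w => [|[x b] w IHw]; first exact: PresRefl.
rewrite /winv /= rev_cons -cats1 -cat_cons catA -[(x, b) :: w]cat1s -(catA _ w).
apply: PresTrans (PresCancel x b); rewrite -[X in pres_eq _ X]cat1s.
apply: PresCat (PresRefl _); rewrite -[X in pres_eq _ X]cats0.
exact: PresCat (PresRefl _) IHw.
Qed.

Lemma pres_mulE u v : pres_mul (pres_class u) (pres_class v) = pres_class (u ++ v).
Proof. by apply/pres_classP/PresCat; exact: pres_classK. Qed.

Lemma pres_mulA : associative pres_mul.
Proof.
move=> f g h; rewrite -(pres_reprK f) -(pres_reprK g) -(pres_reprK h).
by rewrite !pres_mulE catA.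
Qed.

Lemma pres_mul1 : left_id pres_one pres_mul.
Proof. by move=> g; rewrite -(pres_reprK g) pres_mulE. Qed.

Lemma pres_mulr1 : right_id pres_one pres_mul.
Proof. by move=> g; rewrite -(pres_reprK g) pres_mulE cats0. Qed.

Lemma pres_mulrV : right_inverse pres_one pres_inv pres_mul.
Proof.
by move=> g; rewrite -{1}(pres_reprK g) pres_mulE; apply/pres_classP/winv_cat.
Qed.

Lemma pres_mulV : left_inverse pres_one pres_inv pres_mul.
Proof.
move=> g; rewrite -{2}(pres_reprK g) pres_mulE; apply/pres_classP.
by rewrite -{2}(winvK (pres_repr g)); exact: winv_cat.
Qed.

HB.instance Definition _ := isGroup.Build presented
  pres_mulA pres_mul1 pres_mulr1 pres_mulV pres_mulrV.

Definition pres_gen (x : X) : presented := pres_class [:: (x, false)].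

End Presentation.

(** The universal property of [presented R]. *)
Section UniversalProperty.
Variables (X : Type) (R : word X -> word X -> Prop) (H : groupType) (f : X -> H).

Definition word_eval (w : word X) : H :=
  foldr (fun a h => (if a.2 then (f a.1)^-1 else f a.1) * h) 1 w.

Lemma word_eval_cat u v : word_eval (u ++ v) = word_eval u * word_eval v.
Proof. by elim: u => [|a u IHu] /=; rewrite ?mul1g // IHu mulgA. Qed.

Hypothesis fR : forall u v, R u v -> word_eval u = word_eval v.

Definition pres_lift (g : presented R) : H := word_eval (pres_repr g).

Lemma pres_eq_eval u v : pres_eq R u v -> word_eval u = word_eval v.
Proof.
elim=> {u v} [||u u' v v' _ IHu _ IHv|//|//|u v w _ -> //]; first exact: fR.
  by move=> x [] /=; rewrite mulg1 ?mulVg ?mulgV.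
by rewrite !word_eval_cat IHu IHv.
Qed.

Lemma pres_lift_class w : pres_lift (pres_class R w) = word_eval w.
Proof. exact/pres_eq_eval/pres_classK. Qed.

Lemma pres_lift_gen x : pres_lift (pres_gen R x) = f x.
Proof. by rewrite pres_lift_class /= mulg1. Qed.

Lemma pres_liftM : {morph pres_lift : g h / g * h}.
Proof.
move=> g h; rewrite -(pres_reprK g) -(pres_reprK h).
by rewrite [_ * _]pres_mulE !pres_lift_class word_eval_cat.
Qed.

Lemma pres_lift_unique (phi : presented R -> H) :
  {morph phi : g h / g * h} -> (forall x, phi (pres_gen R x) = f x) ->
  phi =1 pres_lift.
Proof.
move=> phiM phi_gen g; rewrite -(pres_reprK g) pres_lift_class.
have phi1 : phi 1 = 1 by apply: (mulgI (phi 1)); rewrite -phiM !mulg1.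
have phiV h : phi h^-1 = (phi h)^-1.
  by apply: (mulgI (phi h)); rewrite -phiM !mulgV.
elim: (pres_repr g) => [|[x b] w IHw] //=.
rewrite -IHw -[_ :: w]cat1s -[pres_class _ _]pres_mulE [LHS]phiM -(phi_gen x).
case: b => //; rewrite -phiV; congr (phi _ * _).
apply: (mulgI (pres_gen R x)); rewrite mulgV.
by rewrite [_ * _]pres_mulE; apply/pres_classP/PresCancel.
Qed.

End UniversalProperty.

(** * The structure group of a rack *)

Section StructureGroup.
Variable X : rackType.

(** The relations [x y = y (x ◁ y)]. *)
Inductive structure_rel : word X -> word X -> Prop :=
| StructureRel x y :
    structure_rel [:: (x, false); (y, false)] [:: (y, false); (x ◁ y, false)].

Definition structure_group : groupType := presented structure_rel.

Definition structure_map (x : X) : structure_group := pres_gen structure_rel x.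

Definition injective_rack : Prop := injective structure_map.

End StructureGroup.

(* Main.v *)
Require Import Defs.
From HB Require Import structures.
From mathcomp Require Import all_boot all_fingroup.
From mathcomp Require Import boolp classical_sets.
From mathcomp Require Import cyclic ssralg ssrint.

Set Implicit Arguments.
Unset Strict Implicit.
Unset Printing Implicit Defensive.

(** A rack that embeds in some conjugation quandle is injective by the
universal property of the structure group ([injective_rack_conj]), so the
content is that an injective finite rack [X] embeds in the conjugation quandle
of a finite group.

Choose [d > 1] such that the [d]-th iterate of every right translation of [X]
is the identity.  In the structure group [G] the powers [x ^+ d] of the
generators are then central.  Let [F] be the quotient of [G] by the subgroup
they generate, presented here by the extra relations [x ^+ d = 1].

- [F] is finite ([finite_of_torsion]).  Its elements are products of generators,
  and because the generators are permuted by conjugation, all occurrences of one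
  generator can be brought to the front of a product and reduced modulo [d];
  by pigeonhole, bounded lengths suffice.

- [X] still embeds in [F] ([truncated_map_inj]).  If [x] and [y] become equal in
  [F], then [c * x = c' * y] in [G], where [c] and [c'] are products of [d]-th
  powers of generators ([truncated_eq_power_prod]).  Counting the generators that
  lie in a set stable under right translations is a morphism from [G] to the integers.
  It takes multiples of [d] on [c] and [c'], and only 0 or 1 on [x] and [y];
  since [d > 1], it agrees on [x] and [y], hence on [c] and [c'].  Applied to
  the fibres of [z |-> z ^+ d], this shows that [c] and [c'] are products of the
  same central elements up to order, so [c = c'], and [x = y] in [G]
  ([structure_map_truncated_inj]).  Injectivity of [X] concludes. *)

Import Algebra.
Local Open Scope group_scope.

(** * Products in groups and finite groups *)

Lemma perm_prodg_commute (G : monoidType) (s t : seq G) :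
  {in s &, forall g h, commute g h} -> perm_eq s t ->
  \prod_(g <- s) g = \prod_(g <- t) g.
Proof.
move=> comm_s st.
pose P u := {subset u <= s} -> \prod_(g <- s) g = \prod_(g <- u) g.
suff: P t by apply=> g; rewrite (perm_mem st).
apply: (@catCA_perm_ind _ P _ _ _ st) => // s1 s2 s3 Ps sub.
rewrite Ps => [|g]; last first.
  by move=> gs; apply: sub; move: gs; rewrite !mem_cat orbCA.
rewrite !big_cat /= !mulgA; congr (_ * _).
rewrite [X in X * _]big_seq [X in _ * X]big_seq [in RHS]big_seq.
rewrite [X in _ = _ * X]big_seq; apply: commute_prod => h hs2.
apply/commute_sym/commute_prod => g gs1.
by apply: comm_s; apply: sub; rewrite !mem_cat ?hs2 ?gs1 ?orbT.
Qed.

(** Finiteness of a group is obtained below as an injection into a finite type;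
this turns such an injection into a [finGroupType] with the same operations. *)
Section FiniteGroup.
Variables (G : groupType) (T : finType) (f : G -> T) (g : T -> G).

Definition finite_group of cancel f g : Type := G.

Hypothesis fK : cancel f g.

HB.instance Definition _ := Group.on (finite_group fK).
HB.instance Definition _ :=
  Choice_isCountable.Build (finite_group fK) (pcan_pickleK (can_pcan fK)).
HB.instance Definition _ := isFinite.Build (finite_group fK)
  (@pcan_enumP (finite_group fK) T f _ (can_pcan fK)).

End FiniteGroup.

(** * Presented groups and rack morphisms to conjugation quandles *)

Lemma pres_class_gen X (R : word X -> word X -> Prop) (w : word X) :
  pres_class R w = word_eval (pres_gen R) w.
Proof.
elim: w => [//|[x b] w IHw].
rewrite -[_ :: w]cat1s -pres_mulE /= -IHw; congr (_ * _); case: b => //=.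
apply: (mulgI (pres_gen R x)); rewrite mulgV.
by rewrite [_ * _]pres_mulE; apply/pres_classP/PresCancel.
Qed.

Lemma word_eval_nseq X (H : groupType) (f : X -> H) n x :
  word_eval f (nseq n (x, false)) = f x ^+ n.
Proof. by elim: n => //= n ->; rewrite expgS. Qed.

Lemma structure_mapM (X : rackType) (x y : X) :
  structure_map (x ◁ y) = structure_map x ^ structure_map y.
Proof.
apply: (mulgI (structure_map y)); rewrite -conjgC.
by rewrite /= [LHS]pres_mulE [RHS]pres_mulE; apply/pres_classP/PresSym/PresRel.
Qed.

Section ConjMorphism.
Variables (X : rackType) (H : groupType) (f : X -> H).
Hypothesis fM : forall x y, f (x ◁ y) = f x ^ f y.

Lemma conj_morph_eval u v :
  structure_rel u v -> word_eval f u = word_eval f v.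
Proof. by case=> x y /=; rewrite !mulg1 fM -conjgC. Qed.

(** Conjugation by powers of [f y] stays among the values of [f]: this is what
makes the finiteness of the rack control the group. *)
Lemma conj_morph_iter n x y : f x ^ (f y ^+ n) = f (iter n (rack_op^~ y) x).
Proof.
by elim: n => [|n IHn]; rewrite ?conjg1 // expgSr conjgM IHn -fM.
Qed.

Lemma injective_rack_conj : injective f -> injective_rack X.
Proof.
move=> f_inj x y /(congr1 (pres_lift f)).
by rewrite !(pres_lift_gen conj_morph_eval) => /f_inj.
Qed.

(** The image is a subquandle: its right translations are surjective because
those of [X] are. *)
Lemma conj_morph_subquandle : injective f ->
  exists S : subquandle (conj_quandle H), rack_isomorphic X (subquandle_type S).
Proof.
move=> f_inj.
have op (g h : conj_quandle H) : range f g -> range f h -> range f (g ◁ h).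
  by move=> [x _ <-] [y _ <-]; exists (x ◁ y); rewrite ?fM.
have surj (g h : conj_quandle H) : range f g -> range f h ->
    exists2 k : conj_quandle H, range f k & k ◁ h = g.
  move=> [x _ <-] [y _ <-]; have [k _ kK] := rack_op_bij y.
  by exists (f (k x)); [exists (k x) | rewrite -[RHS](congr1 f (kK x)) fM].
pose S := SubQuandle op surj; exists S.
have fS x : subquandle_set S (f x) by exists x.
exists (fun x => SigSub (mem_set (fS x))); split.
  have inv (z : subquandle_type S) : exists x, f x = val z.
    by have [x _ fx] := set_valP z; exists x.
  have [k kK] := choice inv.
  by exists k => [x | z]; [apply: f_inj | apply: val_inj]; rewrite /= kK.
by move=> x y; apply: val_inj; rewrite /= fM.
Qed.

End ConjMorphism.

(** * Finiteness of groups generated by torsion elements of a rack *)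

Section Finiteness.
Variables (X : finRackType) (H : groupType) (f : X -> H) (d : nat).
Hypothesis fM : forall x y, f (x ◁ y) = f x ^ f y.

Lemma prodg_nseq n x : \prod_(y <- nseq n x) f y = f x ^+ n.
Proof.
by elim: n => [|n IHn]; rewrite ?big_nil // big_cons IHn expgS.
Qed.

(** The occurrences of [x] move to the front past the other factors, at the cost
of conjugating them, which replaces them by other values of [f]. *)
Lemma prodg_front x s : exists2 t,
  \prod_(y <- s) f y = f x ^+ count_mem x s * \prod_(y <- t) f y
  & (count_mem x s + size t = size s)%N.
Proof.
elim: s => [|y s [t st size_t]]; first by exists [::]; rewrite ?mul1g.
rewrite big_cons st /=; have [->|neq] := eqVneq y x.
  by exists t; [rewrite expgS mulgA | rewrite add1n addSn size_t].
exists (iter (count_mem x s) (rack_op^~ x) y :: t).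
  by rewrite big_cons -(conj_morph_iter fM) [RHS]mulgA -conjgC mulgA.
by rewrite addnS size_t.
Qed.

Hypotheses (d_gt0 : 0 < d) (fX : forall x, f x ^+ d = 1).

(** If all generators occur less than [d] times in [s], then [s] is already
short; otherwise one of them can be brought to the front and [d] of its
occurrences deleted. *)
Lemma prodg_shorten s : exists2 t,
  \prod_(y <- s) f y = \prod_(y <- t) f y & size t <= #|X| * d.
Proof.
have [n] := ubnP (size s); elim: n s => // n IHn s /ltnSE le_s_n.
have [s_small|s_big] := leqP (size s) (#|X| * d); first by exists s.
have [x x_often] : exists x, d <= count_mem x s.
  apply/existsP; apply: contraLR s_big; rewrite negb_exists -leqNgt.
  move=> /forallP rare.
  rewrite -sum_nat_const -sum1_size (partition_big id xpredT) //=.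
  apply: leq_sum => x _; rewrite sum1_count.
  by apply: ltnW; rewrite ltnNge; exact: rare.
have [t st size_t] := prodg_front x s.
have [|t' tt' size_t'] := IHn (nseq (count_mem x s - d) x ++ t).
  rewrite size_cat size_nseq; apply: leq_trans le_s_n.
  by rewrite -size_t ltn_add2r ltn_subrL d_gt0 (leq_trans d_gt0).
exists t' => //; rewrite -tt' big_cat prodg_nseq.
by rewrite st -{1}(subnK x_often) expgnDr fX mulg1.
Qed.

(** Torsion makes inverse letters superfluous: [f x ^+ d.-1] is the inverse of
[f x]. *)
Lemma word_eval_prodg w : exists s, word_eval f w = \prod_(y <- s) f y.
Proof.
elim: w => [|[x b] w [s IHw]]; first by exists [::]; rewrite big_nil.
exists (nseq (if b then d.-1 else 1%N) x ++ s).
rewrite big_cat prodg_nseq /= IHw; congr (_ * _); case: b => //.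
by apply: (mulgI (f x)); rewrite mulgV -expgS prednK ?fX.
Qed.

Lemma finite_of_torsion : (forall h, exists w, h = word_eval f w) ->
  exists (T : finType) (k : H -> T) (l : T -> H), cancel k l.
Proof.
move=> f_gen; pose T := {n : 'I_(#|X| * d).+1 & n.-tuple X}.
pose l (t : T) := \prod_(y <- tagged t) f y.
have l_surj h : exists t, l t = h.
  have [w ->] := f_gen h; have [s ->] := word_eval_prodg w.
  have [t -> size_t] := prodg_shorten s.
  by exists (Tagged (fun n : 'I_(#|X| * d).+1 => n.-tuple X)
    (in_tuple t : (Ordinal (size_t : size t < _.+1)).-tuple X)).
by have [k kK] := choice l_surj; exists T, k, l.
Qed.

End Finiteness.

(** * The finite quotient of the structure group *)

Inductive truncated_rel (X : rackType) d : word X -> word X -> Prop :=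
| TruncatedStructure u v : structure_rel u v -> truncated_rel d u v
| TruncatedPower x : truncated_rel d (nseq d (x, false)) [::].

Section Truncation.
Variable X : finRackType.

(** Any common multiple of the orders of the right translations would do, except
that it must exceed 1 for the degree argument; the factor 2 ensures this when
[X] has at most one element. *)
Definition rack_exponent := #|{perm X}|.*2.
Local Notation d := rack_exponent.

Lemma rack_exponent_gt1 : 1 < d.
Proof. by rewrite -(doubleS 0) leq_double; apply/card_gt0P; exists 1. Qed.

Lemma iter_rack_exponent (x y : X) : iter d (rack_op^~ y) x = x.
Proof.
pose p := perm (bij_inj (rack_op_bij y)).
have p1 : p ^+ d = 1.
  by rewrite /rack_exponent -muln2 expgnA -cardsT expg_cardG ?inE ?expg1n.
rewrite -[RHS]perm1 -p1 permX.
by apply: eq_iter => z; rewrite permE.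
Qed.

Let G := structure_group X.
Local Notation i := (@structure_map X).

Lemma gen_exponent_central (x : X) (g : G) : commute (i x ^+ d) g.
Proof.
rewrite -(pres_reprK g) pres_class_gen.
elim: (pres_repr g) => [|[y b] w IHw] /=; first exact: commute1.
apply: commuteM => //.
have comm_y : commute (i x ^+ d) (i y).
  apply/commute_sym; rewrite /commute conjgC.
  by rewrite (conj_morph_iter (@structure_mapM X)) iter_rack_exponent.
by case: b => //; apply: commuteV.
Qed.

Definition power_prod (s : seq X) : G := \prod_(x <- s) i x ^+ d.

Lemma power_prod_central s g : commute (power_prod s) g.
Proof.
apply/commute_sym/commute_prod => x _.
exact/commute_sym/gen_exponent_central.
Qed.

Lemma power_prod_cat s t : power_prod (s ++ t) = power_prod s * power_prod t.
Proof. exact: big_cat. Qed.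

Lemma power_prod_catM s t g h :
  power_prod (s ++ t) * (g * h) = power_prod s * g * (power_prod t * h).
Proof.
rewrite power_prod_cat mulgA -(mulgA (power_prod s)).
by rewrite (power_prod_central t g) !mulgA.
Qed.

(** Equality in the quotient of [G] by the subgroup generated by the [i x ^+ d].
An element of that subgroup is a fraction of two values of [power_prod]; writing
one on each side avoids inverses. *)
Lemma truncated_eq_power_prod u v : pres_eq (truncated_rel d) u v ->
  exists s t, power_prod s * word_eval i u = power_prod t * word_eval i v.
Proof.
elim=> {u v} [u v [{}u {}v uv | x]|x b|u u' v v' _ [s [t st]] _ [s' [t' st']]
  |u|u v _ [s [t st]]|u v w _ [s [t st]] _ [s' [t' st']]].
- exists [::], [::]; congr (_ * _).
  by apply: conj_morph_eval uv; exact: structure_mapM.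
- exists [::], [:: x]; rewrite /power_prod big_nil big_seq1 mulg1 mul1g.
  exact: word_eval_nseq.
- exists [::], [::]; congr (_ * _) => /=.
  by case: b; rewrite /= mulg1 ?mulVg ?mulgV.
- exists (s ++ s'), (t ++ t').
  by rewrite !word_eval_cat !power_prod_catM st st'.
- by exists [::], [::].
- by exists t, s.
exists (s' ++ s), (t ++ t').
by rewrite !power_prod_cat -!mulgA st -st' !mulgA (power_prod_central s').
Qed.

(** Counting the generators that satisfy [q] respects the relations
[x y = y (x ◁ y)] exactly when [q] is invariant under right translations. *)
Section Degree.
Variable q : pred X.
Hypothesis qM : forall x y, q (x ◁ y) = q x.

Let weight (x : X) : to_multiplicative int := Posz (q x).
Definition degree : G -> to_multiplicative int := pres_lift weight.

Lemma degree_rel u v :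
  structure_rel u v -> word_eval weight u = word_eval weight v.
Proof.
apply: conj_morph_eval => x y.
by rewrite /weight qM conjgE (commuteT _ (weight y)) mulKg.
Qed.

Lemma degree_power_prod s x :
  degree (power_prod s * i x) = Posz (count q s * d + q x)%N.
Proof.
have degM : {morph degree : g h / g * h} := pres_liftM degree_rel.
have deg_gen y : degree (i y) = Posz (q y) := pres_lift_gen degree_rel y.
have deg1 : degree 1 = 1 by apply: (mulgI (degree 1)); rewrite -degM !mulg1.
have degX y n : degree (i y ^+ n) = Posz (q y * n)%N.
  elim: n => [|n IHn]; first by rewrite muln0.
  by rewrite expgS degM IHn deg_gen mulnS PoszD.
rewrite degM deg_gen PoszD; congr (_ + _)%R.
elim: s => [|y s IHs]; first by rewrite /power_prod big_nil.
by rewrite /power_prod big_cons degM IHs degX /= mulnDl PoszD.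
Qed.

End Degree.

(** The two products of central [d]-th powers have the same factors up to order,
since reducing degrees modulo [d] shows that [x] and [y] have the same degrees,
whence so do the two products. *)
Lemma structure_map_truncated_inj s t x y :
  power_prod s * i x = power_prod t * i y -> i x = i y.
Proof.
move=> st; suff st_eq : power_prod s = power_prod t.
  by apply: (mulgI (power_prod s)); rewrite {2}st_eq.
(* The fibres of [key] are unions of orbits of [X], so each has a degree. *)
pose key z := i z ^+ d.
have keyM z z' : key (z ◁ z') = key z.
  rewrite /key structure_mapM -conjXg; apply/conjg_fixP.
  exact/commgP/gen_exponent_central.
suff key_st : perm_eq (map key s) (map key t).
  rewrite /power_prod -!(big_map key xpredT id).
  apply: perm_prodg_commute key_st.
  by move=> _ h /mapP[z _ ->] _; exact: gen_exponent_central.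
apply/allP => g _; apply/eqP; rewrite /= !count_map.
set q := preim _ _; have qM z z' : q (z ◁ z') = q z by rewrite /q /= keyM.
have := degree_power_prod qM s x; rewrite st degree_power_prod // => -[deg_st].
have d_gt1 := rack_exponent_gt1.
(* Modulo [d] only [i x] and [i y] contribute to the degrees. *)
have small (b : bool) : b < d by case: b => //; apply: ltnW.
have q_xy : q y = q x :> nat.
  by have := congr1 (modn^~ d) deg_st; rewrite !modnMDl !modn_small.
by move/eqP: deg_st; rewrite q_xy eqn_add2r eqn_pmul2r ?(ltnW d_gt1) // => /eqP.
Qed.

Definition truncated_map (x : X) : presented (truncated_rel d) := pres_gen _ x.

Lemma truncated_mapM x y :
  truncated_map (x ◁ y) = truncated_map x ^ truncated_map y.
Proof.
apply: (mulgI (truncated_map y)); rewrite -conjgC [LHS]pres_mulE [RHS]pres_mulE.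
by apply/pres_classP/PresSym/PresRel/TruncatedStructure.
Qed.

Lemma truncated_mapX x : truncated_map x ^+ d = 1.
Proof.
transitivity (pres_class (truncated_rel d) (nseq d (x, false))).
  by rewrite pres_class_gen word_eval_nseq.
exact/pres_classP/PresRel/TruncatedPower.
Qed.

Lemma truncated_map_inj : injective_rack X -> injective truncated_map.
Proof.
move=> X_inj x y /pres_classP /truncated_eq_power_prod[s [t]] /=.
by rewrite !mulg1 => /structure_map_truncated_inj /X_inj.
Qed.

Lemma injective_rack_finite_conj : injective_rack X ->
  exists (H : finGroupType) (f : X -> H),
    injective f /\ forall x y, f (x ◁ y) = f x ^ f y.
Proof.
move=> X_inj.
have [|T [k [l kK]]] := finite_of_torsion truncated_mapM
    (ltnW rack_exponent_gt1) truncated_mapX.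
  by move=> h; exists (pres_repr h); rewrite -pres_class_gen pres_reprK.
exists (finite_group kK), truncated_map.
by split; [exact: truncated_map_inj | exact: truncated_mapM].
Qed.

End Truncation.

Theorem corollary4p4 (X : finRackType) :
  [<-> injective_rack X;
       exists (H : finGroupType) (S : subquandle (conj_quandle H)),
         rack_isomorphic X (subquandle_type S);
       exists (H : groupType) (S : subquandle (conj_quandle H)),
         rack_isomorphic X (subquandle_type S)].
Proof.
tfae.
- move=> /injective_rack_finite_conj[H [f [f_inj fM]]].
  by exists H; exact: conj_morph_subquandle fM f_inj.
- by move=> [H [S XS]]; exists H, S.
move=> [H [S [f [/bij_inj f_inj fM]]]].
apply: (@injective_rack_conj X H (fun x => val (f x))) => x y.
  by rewrite fM.
by move=> /val_inj/f_inj.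
Qed.
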